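(* For each $n$ let $X_{1,n},\dots,X_{n,n}$ be i.i.d. from $\mathbb F_n$, with mean $\mu_n=\mu<0$ (not depending on $n$) and variance $1$, and let $\bar X_n=\frac1n\sum_{i=1}^nX_{i,n}$. Let $\omega\sim\mathrm{Logistic}(\kappa)$ be independent of the data. Suppose there exist $a>0$ and $C<\infty$ such that $$\mathbb E_{\mathbb F_n}\left[\exp\left(a|X_{i,n}-\mu_n|\right)\right]\le C\quad\text{for all }n .$$ Then the sample means surviving the randomized file drawer effect are consistent for $\mu$: conditionally on $\sqrt n\bar X_n+\omega>2$, $\bar X_n\to\mu$ in probability, i.e. for every $\epsilon>0$, $$\mathbb P\left(|\bar X_n-\mu|>\epsilon\ \middle|\ \sqrt n\bar X_n+\omega>2\right)\to0\quad\text{as }n\to\infty .$$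
   Context: $\mathrm{Logistic}(\kappa)$, $\kappa>0$ (called the scale parameter), is the distribution with CDF $G(w)=e^{\kappa w}/(1+e^{\kappa w})$. *)

(* Defs.v *)
From HB Require Import structures.
From mathcomp Require Export all_boot all_order all_algebra.
From mathcomp Require Export all_classical all_reals all_analysis.

Set Implicit Arguments.
Unset Strict Implicit.
Unset Printing Implicit Defensive.

Import Order.TTheory GRing.Theory Num.Theory.
Import numFieldNormedType.Exports.

Local Open Scope classical_set_scope.
Local Open Scope ring_scope.

Section probability_notions.
Context {d : measure_display} {T : measurableType d} {R : realType}.
Variable P : probability T R.

Definition has_law (X : {RV P >-> R}) (F : probability R R) : Prop :=
  forall A : set R, measurable A -> distribution P X A = F A.

Definition mutually_independent (n : nat) (X : 'I_n -> {RV P >-> R}) : Prop :=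
  forall (J : {set 'I_n}) (A : 'I_n -> set R),
    (forall i, i \in J -> measurable (A i)) ->
    P (\bigcap_(i in [set` J]) (X i @^-1` A i))
      = (\prod_(i in J) P (X i @^-1` A i))%E.

Definition iid_sample (n : nat) (X : 'I_n -> {RV P >-> R})
    (F : probability R R) : Prop :=
  mutually_independent X /\ forall i, has_law (X i) F.

(* Independence of [Y] from the random vector (X_0, ..., X_{n-1}): every event
   of the sigma-algebra generated jointly by all the X_i is independent of
   every event [Y \in B] (not just of the individual X_i). *)
Definition independent_of_data (n : nat) (X : 'I_n -> {RV P >-> R})
    (Y : {RV P >-> R}) : Prop :=
  forall (A : set T) (B : set R),
    g_sigma_preimage (fun i => X i : T -> R) A -> measurable B ->
    P (A `&` Y @^-1` B) = (P A * P (Y @^-1` B))%E.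

Definition logistic_law (kappa : R) (Y : {RV P >-> R}) : Prop :=
  forall w : R, cdf Y w = (expR (kappa * w) / (1 + expR (kappa * w)))%:E.

Definition sample_mean (n : nat) (X : 'I_n -> {RV P >-> R}) (t : T) : R :=
  n%:R^-1 * \sum_(i < n) X i t.

(* P(A | B) = P(A /\ B) / P(B), with the convention that it is 0 if P(B) = 0.
   The convention is never used for the selection event
   [sqrt n * mean + Y > 2]: when Y is logistic and independent of the data,
   that event has positive probability. *)
Definition cond_prob (A B : set T) : R := fine (P (A `&` B)) / fine (P B).

End probability_notions.

(* Main.v *)
Require Import Defs.
From HB Require Import structures.
From mathcomp Require Import measurable_realfun ring lra.

(** The denominator of the conditional probability decays only like
    exp (- O (sqrt n)), whereas the probability of a deviation decays
    exponentially in n; so conditioning on selection cannot make a deviation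
    of fixed size likely.

    Denominator. Write L = eps - mu and w = 2 + sqrt n * L.  If the sample mean
    is within eps of mu, the study is selected as soon as omega > w.  By
    independence, selection has probability at least
    P (|mean - mu| <= eps) * P (omega > w), and the logistic tail at w >= 0
    is at least exp (- kappa * w) / 2 ([logistic_upper_tail],
    [cond_prob_selection_le]).

    Numerator. It is bounded by the unconditional probability of a deviation.
    From e^x <= 1 + x + x^2 e^|x| and the exponential moment bound,
    E exp (s (X - mu)) <= exp (K s^2) for |s| <= a / 2, with
    K = 16 C / a^2 the same for all n ([mgf_bound]).  The Chernoff bound
    ([sample_mean_tail]) with a small fixed s gives
    P (|mean - mu| > eps) <= 2 exp (- c n).  It rests on the product formula
    for the expectation of independent nonnegative factors
    ([expectation_prod_indep]), which is derived from independence of events.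

    Hence the conditional probability is at most
    8 exp (kappa * (2 + sqrt n * L) - c n) once 2 exp (- c n) <= 1/2, and the
    linear term wins ([sqrt_le_linear]). *)

Set Implicit Arguments.
Unset Strict Implicit.
Unset Printing Implicit Defensive.

Import Order.TTheory GRing.Theory Num.Theory.
Import numFieldNormedType.Exports.

Local Open Scope classical_set_scope.
Local Open Scope ring_scope.

(** * Expectation of a product of independent variables *)

Section product_expectation.
Context {d : measure_display} {T : measurableType d} {R : realType}.
Variable P : probability T R.
Import HBNNSimple.
Local Open Scope ereal_scope.

Lemma expectationE (f : T -> R) : 'E_P[f] = \int[P]_t (f t)%:E.
Proof. by rewrite unlock. Qed.

(** A simple function is a finite combination of indicators of its level sets,
    so the product rule extends to it by linearity. *)
Lemma expectation_mul_simple (h : T -> R) (Y : {RV P >-> R})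
    (g : {nnsfun R >-> R}) :
  measurable_fun setT h -> (forall t, (0 <= h t)%R) ->
  (forall A, measurable A ->
     'E_P[fun t => (h t * \1_A (Y t))%R] = 'E_P[h] * P (Y @^-1` A)) ->
  'E_P[fun t => (h t * g (Y t))%R] = 'E_P[h] * 'E_P[g \o Y].
Proof.
move=> mh h0 hY.
have mA y : measurable (g @^-1` [set y]).
  by rewrite -[X in measurable X]setTI; apply: measurable_funP.
have mI y : measurable_fun setT (fun t => \1_(g @^-1` [set y]) (Y t) : R).
  by apply: measurableT_comp => //; exact: measurable_indic.
have mlevel y : measurable_fun setT
    (fun t => (y * \1_(g @^-1` [set y]) (Y t))%:E).
  by apply/measurable_EFinP; exact: measurable_funM.
have level_ge0 y t : 0 <= y%:E * (\1_(g @^-1` [set y]) (Y t))%:E.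
  exact: nnfun_muleindic_ge0.
have gE t : (g (Y t))%:E =
    \sum_(y \in range g) y%:E * (\1_(g @^-1` [set y]) (Y t))%:E.
  by rewrite fimfunE -fsumEFin.
have Eg : 'E_P[g \o Y] =
    \sum_(y \in range g) y%:E * P (Y @^-1` (g @^-1` [set y])).
  rewrite unlock; under eq_integral do rewrite gE.
  rewrite ge0_integral_fsum//; apply: eq_fsbigr => y /set_mem[x _ gxy].
  rewrite ge0_integralZl//; last 2 first.
  - exact/measurable_EFinP.
  - by rewrite -gxy lee_fin.
  congr (_ * _); rewrite -expectation_indic; last first.
    by rewrite -[X in measurable X]setTI; exact: measurable_funP.
  by rewrite unlock.
rewrite Eg ge0_mule_fsumr; last first.
  move=> y; have [->|/set0P[t /= gYt]] := eqVneq (Y @^-1` (g @^-1` [set y])) set0.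
    by rewrite measure0 mule0.
  by rewrite mule_ge0// -gYt lee_fin.
rewrite [LHS]expectationE; under eq_integral => t _.
  rewrite EFinM gE ge0_mule_fsumr//; over.
rewrite ge0_integral_fsum//; last 2 first.
- by move=> y; apply: emeasurable_funM; [exact/measurable_EFinP|exact: mlevel].
- by move=> y t _; rewrite mule_ge0// lee_fin.
apply: eq_fsbigr => y /set_mem[x _ gxy].
under eq_integral do rewrite muleCA -[((h _)%:E * _)]EFinM.
rewrite ge0_integralZl//; last 3 first.
- by apply/measurable_EFinP; exact: measurable_funM.
- by move=> t _; rewrite lee_fin mulr_ge0.
- by rewrite -gxy lee_fin.
rewrite [RHS]muleCA; congr (_ * _).
by rewrite -hY// expectationE.
Qed.

(** The hypothesis says that [h] is independent of [Y] only to the extent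
    that it is uncorrelated with the indicators of events about [Y].  Both
    sides of the conclusion are continuous along the increasing simple
    approximations of [f], by monotone convergence; finiteness of ['E_P[h]]
    is what lets the limit pass through the multiplication on the right. *)
Lemma expectation_mul_comp (h : T -> R) (Y : {RV P >-> R}) (f : R -> R) :
  measurable_fun setT h -> (forall t, (0 <= h t)%R) -> 'E_P[h] \is a fin_num ->
  (forall A, measurable A ->
     'E_P[fun t => (h t * \1_A (Y t))%R] = 'E_P[h] * P (Y @^-1` A)) ->
  measurable_fun setT f -> (forall x, (0 <= f x)%R) ->
  'E_P[fun t => (h t * f (Y t))%R] = 'E_P[h] * 'E_P[f \o Y].
Proof.
move=> mh h0 hfin hY mf f0.
have mf' : measurable_fun setT (EFin \o f) by exact/measurable_EFinP.
pose g := nnsfun_approx measurableT mf'.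
have mg n : measurable_fun setT (fun t => g n (Y t)).
  exact: measurableT_comp.
have ndg t : {homo (fun n => g n (Y t)) : m n / (m <= n)%N >-> (m <= n)%R}.
  by move=> m n mn; exact/lefP/nd_nnsfun_approx.
have cvgg t : (g n (Y t))%:E @[n --> \oo] --> (f (Y t))%:E.
  by apply: (cvg_nnsfun_approx measurableT mf') => // x _; rewrite lee_fin.
have Ef : 'E_P[g n \o Y] @[n --> \oo] --> 'E_P[f \o Y].
  rewrite expectationE; under eq_integral do rewrite -(cvg_lim _ (cvgg _))//.
  rewrite (_ : (fun n => _) = fun n => \int[P]_t (g n (Y t))%:E); last first.
    by apply/funext => n; rewrite expectationE.
  apply: cvg_monotone_convergence => //.
  - by move=> n; exact/measurable_EFinP.
  - by move=> n t _; rewrite lee_fin.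
  - by move=> t _ m n mn; rewrite lee_fin ndg.
have Ehf : 'E_P[fun t => (h t * g n (Y t))%R] @[n --> \oo] -->
    'E_P[fun t => (h t * f (Y t))%R].
  have cvgh t : (h t * g n (Y t))%:E @[n --> \oo] --> (h t * f (Y t))%:E.
    rewrite EFinM; under eq_fun do rewrite EFinM.
    by apply: cvgeZl => //; exact: cvgg.
  rewrite expectationE; under eq_integral do rewrite -(cvg_lim _ (cvgh _))//.
  rewrite (_ : (fun n => 'E_P[_]) = fun n => \int[P]_t (h t * g n (Y t))%:E);
    last by apply/funext => n; rewrite expectationE.
  apply: cvg_monotone_convergence => //.
  - by move=> n; apply/measurable_EFinP; exact: measurable_funM.
  - by move=> n t _; rewrite lee_fin mulr_ge0.
  - by move=> t _ m n mn; rewrite lee_fin ler_wpM2l// ndg.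
apply/esym/(cvg_unique _ _ Ehf) => //.
rewrite (_ : (fun n => 'E_P[_]) = fun n => 'E_P[h] * 'E_P[g n \o Y]).
  exact: cvgeZl.
by apply/funext => n; rewrite expectation_mul_simple.
Qed.

(** The factors are turned from indicators into arbitrary functions one index at
    a time.  When all are indicators the formula is mutual independence of the
    corresponding events; replacing the factor at one index is
    [expectation_mul_comp], with [h] the product of the other factors. *)
Lemma expectation_prod_indep (n : nat) (X : 'I_n -> {RV P >-> R})
    (f : 'I_n -> R -> R) :
  mutually_independent X ->
  (forall i, measurable_fun setT (f i)) -> (forall i x, (0 <= f i x)%R) ->
  (forall i, 'E_P[f i \o X i] \is a fin_num) ->
  'E_P[fun t => (\prod_(i < n) f i (X i t))%R] =
  \prod_(i < n) 'E_P[f i \o X i].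
Proof.
move=> indX.
have mXA i A : measurable A -> measurable (X i @^-1` A).
  by move=> mA; rewrite -[X in measurable X]setTI; exact: measurable_funP.
have E1 i A : measurable A -> 'E_P[(\1_A : R -> R) \o X i] = P (X i @^-1` A).
  by move=> mA; rewrite -expectation_indic//; exact: mXA.
(* Factors of index at least k are still indicators. *)
suff main k : forall f : 'I_n -> R -> R,
    (forall i, measurable_fun setT (f i)) -> (forall i x, (0 <= f i x)%R) ->
    (forall i, 'E_P[f i \o X i] \is a fin_num) ->
    (forall i : 'I_n, (k <= i)%N -> exists2 A, measurable A & f i = \1_A) ->
    'E_P[fun t => (\prod_(i < n) f i (X i t))%R] =
    \prod_(i < n) 'E_P[f i \o X i].
  move=> mf f0 ffin; apply: (main n) => // i.
  by rewrite leqNgt ltn_ord.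
elim: k => [|k IHk] {}f mf f0 ffin find.
  have /choice[A fA] : forall i, exists A, measurable A /\ f i = \1_A.
    by move=> i; have [A] := find i (leq0n _); exists A.
  rewrite [RHS](eq_bigr (fun i => P (X i @^-1` A i))); last first.
    by move=> i _; rewrite (fA i).2 E1//; exact: (fA i).1.
  have indA : P (\bigcap_(i in [set` [set: 'I_n]%SET]) (X i @^-1` A i)) =
      \prod_(i < n) P (X i @^-1` A i).
    rewrite indX => [|i _]; last exact: (fA i).1.
    by apply: eq_bigl => i; rewrite inE.
  rewrite -indA -expectation_indic; last first.
    by apply: fin_bigcap_measurable => // i _; apply: mXA; exact: (fA i).1.
  congr (expectation _ _); apply/funext => t.
  under eq_bigr do rewrite (fA _).2.
  have [tA|tA] := pselect ((\bigcap_(i in [set` [set: 'I_n]%SET]) (X i @^-1` A i)) t).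
    rewrite indicE mem_set// big1// => i _; rewrite indicE mem_set//.
    by apply: tA => /=; rewrite inE.
  rewrite indicE memNset//.
  have [i nAi] : exists i, ~ A i (X i t).
    by apply: contrapT => /forallNP H; apply: tA => i _; exact: contrapT (H i).
  by rewrite (bigD1 i)//= indicE memNset// mul0r.
have [nk|kn] := leqP n k.
  apply: IHk => // i ki; apply: find.
  by have := leq_ltn_trans ki (ltn_ord i); rewrite ltnNge nk.
pose i0 := Ordinal kn.
pose h t := (\prod_(i < n | i != i0) f i (X i t))%R.
pose c := \prod_(i < n | i != i0) 'E_P[f i \o X i].
have hA A : measurable A -> 'E_P[fun t => (h t * \1_A (X i0 t))%R] = c * P (X i0 @^-1` A).
  move=> mA; pose g i := if i == i0 then (\1_A : R -> R) else f i.
  have gi0 : g i0 = \1_A by rewrite /g eqxx.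
  have gN i : i != i0 -> g i = f i by rewrite /g => /negbTE ->.
  have := IHk g.
  rewrite (bigD1 i0)//= gi0 E1//.
  under eq_bigr => i /gN -> do [].
  rewrite muleC => <-.
  - congr (expectation _ _); apply/funext => t.
    rewrite (bigD1 i0)//= gi0 mulrC; congr (_ * _)%R.
    by apply: eq_bigr => i /gN ->.
  - by move=> i; rewrite /g; case: ifPn => // _; exact: measurable_indic.
  - by move=> i x; rewrite /g; case: ifPn.
  - by move=> i; rewrite /g; case: ifPn => // _; rewrite E1// fin_num_measure//; exact: mXA.
  - move=> i ki; rewrite /g; case: ifPn => [_|ii0]; first by exists A.
    apply: find; rewrite ltn_neqAle ki andbT eq_sym.
    by apply: contra ii0 => /eqP ik; apply/eqP/val_inj.
(* The full event turns the uncorrelatedness identity into the value of E h. *)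
have Eh : 'E_P[h] = c.
  have := hA setT measurableT; rewrite preimage_setT probability_setT mule1 => <-.
  by congr (expectation _ _); apply/funext => t; rewrite indicT mulr1.
have mh : measurable_fun setT h.
  rewrite [h](_ : _ = fun t =>
      (\prod_(i <- [seq i <- index_enum 'I_n | i != i0]) f i (X i t))%R); last first.
    by apply/funext => t; rewrite big_filter.
  by apply: measurable_prod => i _; exact: measurableT_comp.
have h0 t : (0 <= h t)%R by exact: prodr_ge0.
transitivity 'E_P[fun t => (h t * f i0 (X i0 t))%R].
  by congr (expectation _ _); apply/funext => t; rewrite (bigD1 i0)//= mulrC.
rewrite expectation_mul_comp//; last 2 first.
- by rewrite Eh /c; apply: (big_ind (fun x => x \is a fin_num)) => // x y; exact: fin_numM.
- by move=> A mA; rewrite hA// Eh.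
by rewrite Eh [RHS](bigD1 i0)//= muleC.
Qed.
End product_expectation.

(** * A uniform moment generating function bound *)

Section mgf.
Context {R : realType}.

(** Multiplying [1 - x <= expR (- x)] by [expR x] gives
    [expR x - 1 <= x * expR x]; this is applied once to reduce the claim to
    [x * (expR x - 1) <= x ^+ 2 * expR `|x|] and again, for [0 <= x], to prove
    that. *)
Lemma expR_le_quadratic (x : R) : expR x <= 1 + x + x ^+ 2 * expR `|x|.
Proof.
have e1 y : expR y - 1 <= y * expR y :> R.
  have : (1 - y) * expR y <= 1 by rewrite -ler_pdivlMr ?expR_gt0// div1r -expRN expR_ge1Dx.
  by lra.
have h1 := e1 x.
suff : x * (expR x - 1) <= x ^+ 2 * expR `|x| by lra.
have [x0|x0] := leP 0 x.
  by rewrite ger0_norm// expr2 -mulrA ler_wpM2l.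
rewrite ltr0_norm//; have h2 := expR_ge1Dx x.
have h3 : 1 <= expR (- x) by rewrite -expR0 ler_expR; lra.
nra.
Qed.

Lemma sqr_le_expR (a y : R) : 0 < a -> y ^+ 2 <= 16 / a ^+ 2 * expR (a / 2 * `|y|).
Proof.
move=> a0; set u := a / 4 * `|y|.
have u0 : 0 <= u by rewrite mulr_ge0// divr_ge0// ltW.
have h1 : u <= expR u by have := expR_ge1Dx u; lra.
have -> : y ^+ 2 = 16 / a ^+ 2 * u ^+ 2.
  rewrite /u exprMn -normrX ger0_norm ?sqr_ge0//; field; exact: lt0r_neq0.
have -> : a / 2 * `|y| = u + u by rewrite /u; lra.
rewrite expRD -expr2 ler_wpM2l//; first by rewrite divr_ge0// sqr_ge0.
by rewrite ler_sqr ?nnegrE// expR_ge0.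
Qed.

(** Half of the exponential weight [a] pays for the factor [y ^+ 2], the other
    half for [expR `|s * y|]. *)
Lemma mgf_pointwise (a s y : R) : 0 < a -> `|s| <= a / 2 ->
  expR (s * y) <= 1 + s * y + s ^+ 2 * (16 / a ^+ 2) * expR (a * `|y|).
Proof.
move=> a0 sa; apply: le_trans (expR_le_quadratic _) _.
rewrite lerD2l exprMn -!(mulrA (s ^+ 2)) ler_wpM2l ?sqr_ge0//.
apply: (@le_trans _ _ (16 / a ^+ 2 * expR (a / 2 * `|y|) * expR (a / 2 * `|y|))).
  rewrite ler_pM ?sqr_ge0 ?expR_ge0 ?sqr_le_expR//.
  by rewrite ler_expR normrM ler_wpM2r.
by rewrite -mulrA -expRD -mulrDl -splitr.
Qed.

Local Open Scope ereal_scope.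

(** The first-order term of the moment generating function vanishes because
    [mu] is the mean, so it is at most [1 + K * s ^+ 2], with a constant [K]
    that depends on [F] only through [a] and [C]: this is the uniformity over
    the triangular array. *)
Lemma mgf_bound (F : probability R R) (mu a C s : R) : (0 < a)%R ->
  'E_F[fun x : R => x] = mu%:E ->
  'E_F[fun x : R => expR (a * `|x - mu|)%R] <= C%:E ->
  (`|s| <= a / 2)%R ->
  'E_F[fun x : R => expR (s * (x - mu))%R] <= (expR (16 * C / a ^+ 2 * s ^+ 2))%:E.
Proof.
move=> a0 meanF EC sa.
set e := (fun x : R => expR (a * `|x - mu|)%R).
have mabs : measurable_fun [set: R] (fun x : R => `|x - mu|)%R.
  by apply: measurableT_comp => //; exact: measurable_funB.
have me : measurable_fun [set: R] e.
  by apply: measurableT_comp => //; exact: measurable_funM.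
have ie : F.-integrable setT (EFin \o e).
  apply/integrableP; split; first exact/measurable_EFinP.
  under eq_integral => x _ do rewrite /= ger0_norm ?expR_ge0//.
  by move: EC; rewrite expectationE => /le_lt_trans; apply; exact: ltry.
(* a * |x - mu| <= e x gives integrability from the exponential moment. *)
have iy : F.-integrable setT (EFin \o (fun x : R => x - mu)%R).
  apply: (le_integrable measurableT _ _ (integrableZl measurableT a^-1 ie)).
    by apply/measurable_EFinP; exact: measurable_funB.
  move=> x _ /=; rewrite lee_fin normrM gtr0_norm ?invr_gt0//.
  rewrite mulrC ler_pdivlMr// mulrC ger0_norm ?expR_ge0//.
  by rewrite (le_trans _ (expR_ge1Dx _))// lerDr.
have icst (r : R) : F.-integrable setT (EFin \o (fun=> r)).
  exact: finite_measure_integrable_cst.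
have intcst (r : R) : \int[F]_x r%:E = r%:E.
  by have := expectation_cst F r; rewrite expectationE.
have Ey : \int[F]_x ((x - mu)%R)%:E = 0.
  have ix : F.-integrable setT (EFin \o (fun x : R => x)).
    have := integrableD measurableT iy (icst mu).
    by apply: eq_integrable => // x _ /=; rewrite -EFinD subrK.
  rewrite (integralB_EFin measurableT ix (icst mu)) -[X in X - _]expectationE meanF.
  by rewrite intcst subee.
pose k := (s ^+ 2 * (16 / a ^+ 2))%R.
have isy : F.-integrable setT (EFin \o (fun x : R => s * (x - mu))%R).
  exact: (integrableZl measurableT s iy).
have ike : F.-integrable setT (EFin \o (fun x : R => k * e x)%R).
  exact: (integrableZl measurableT k ie).
have i1sy : F.-integrable setT (EFin \o (fun x : R => 1 + s * (x - mu))%R).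
  exact: (integrableD measurableT (icst 1%R) isy).
rewrite expectationE.
apply: (@le_trans _ _ (\int[F]_x (1 + s * (x - mu) + k * e x)%:E)).
  apply: ge0_le_integral => //.
  - apply/measurable_EFinP; apply: measurableT_comp => //.
    by apply: measurable_funM => //; exact: measurable_funB.
  - by apply: (measurable_int F); exact: (integrableD measurableT i1sy ike).
  - by move=> x _; rewrite lee_fin; exact: mgf_pointwise.
rewrite (integralD_EFin measurableT i1sy ike).
rewrite (integralD_EFin measurableT (icst 1%R) isy) intcst.
have -> : \int[F]_x (s * (x - mu))%:E = 0.
  by under eq_integral do rewrite EFinM; rewrite (integralZl measurableT iy) Ey mule0.
have -> : \int[F]_x (k * e x)%:E = k%:E * \int[F]_x (e x)%:E.
  by under eq_integral do rewrite EFinM; rewrite (integralZl measurableT ie).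
rewrite adde0 -expectationE.
apply: (@le_trans _ _ (1 + k * C)%:E); last first.
  rewrite lee_fin (_ : 16 * C / _ * _ = k * C)%R; first exact: expR_ge1Dx.
  by rewrite /k; ring.
rewrite (EFinD 1%R) (EFinM k); apply/leeD2l/lee_wpmul2l => //.
by rewrite lee_fin /k mulr_ge0 ?sqr_ge0// divr_ge0// sqr_ge0.
Qed.
End mgf.

(** * Exponential tail of the sample mean *)

Section sample_mean_tail.
Context {d : measure_display} {T : measurableType d} {R : realType}.
Variable P : probability T R.
Variables (n : nat) (X : 'I_n -> {RV P >-> R}).
Hypothesis n_gt0 : (0 < n)%N.

Lemma measurable_sample_mean : measurable_fun setT (sample_mean X).
Proof.
apply: measurable_funM => //; apply: measurable_sum => i.
exact: measurable_funP.
Qed.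

Lemma measurable_sample_mean_dev (mu b : R) :
  measurable [set t | b < `|sample_mean X t - mu|].
Proof.
rewrite -[X in measurable X]setTI.
have mf : measurable_fun setT (fun t => `|sample_mean X t - mu|).
  apply: measurableT_comp => //; apply: measurable_funB => //.
  exact: measurable_sample_mean.
by have := mf measurableT `]b, +oo[%classic (measurable_itv _); rewrite set_itvoy.
Qed.

Lemma sample_mean_dev (mu : R) t :
  n%:R * (sample_mean X t - mu) = \sum_(i < n) (X i t - mu).
Proof.
rewrite sumrB sumr_const card_ord mulrBr mulr_natl mulr_natl; congr (_ - _).
by rewrite /sample_mean -mulr_natl mulrA divff ?mul1r// pnatr_eq0 -lt0n.
Qed.

(** Independence of [omega] from the data is stated for the sigma-algebra
    generated by the data.  Equipping [T] with that sigma-algebra makes each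
    [X i] measurable by construction, hence the sample mean too. *)
Lemma g_sigma_sample_mean_preimage (B : set R) : measurable B ->
  g_sigma_preimage (fun i => X i : T -> R) (sample_mean X @^-1` B).
Proof.
move=> mB.
pose G := \big[setU/set0]_(i < n)
  preimage_set_system setT (X i : T -> R) measurable.
have mX i : @measurable_fun _ _ (g_sigma_algebraType G) R setT (X i).
  move=> _ A mA; rewrite setTI; apply: sub_sigma_algebra => /=.
  by rewrite /G (bigD1 i)//=; left; exists A => //; rewrite setTI.
have mmean : @measurable_fun _ _ (g_sigma_algebraType G) R setT (sample_mean X).
  by apply: measurable_funM => //; exact: measurable_sum.
by have := mmean measurableT B mB; rewrite setTI.
Qed.

(** The sign of [s] selects the tail: [s > 0] gives the upper one and [s < 0]
    the lower one. *)
Lemma sample_mean_chernoff (F : probability R R) (mu s b M : R) :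
  iid_sample X F ->
  ('E_F[fun x : R => expR (s * (x - mu))%R] <= M%:E)%E ->
  (P [set t | (b <= s * (sample_mean X t - mu))%R]
     <= ((M * expR (- b)) ^+ n)%:E)%E.
Proof.
move=> [indX lawX] EM.
pose f := fun x : R => expR (s * (x - mu)).
have f0 x : 0 <= f x by exact: expR_ge0.
have mf : measurable_fun setT f.
  by apply: measurableT_comp => //; apply: measurable_funM => //; exact: measurable_funB.
have EX i : ('E_P[f \o X i] = 'E_F[f])%E.
  rewrite !expectationE; transitivity (\int[distribution P (X i)]_x (f x)%:E)%E.
    by rewrite ge0_integral_distribution//; exact/measurable_EFinP.
  by apply: eq_measure_integral => A mA _; exact: lawX.
have EF0 : (0 <= 'E_F[f])%E by exact: expectation_ge0.
have EFfin : ('E_F[f])%E \is a fin_num.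
  by rewrite ge0_fin_numE// (le_lt_trans EM)// ltry.
pose Y t := s * \sum_(i < n) (X i t - mu).
have mY : measurable_fun setT Y.
  apply: measurable_funM => //; apply: measurable_sum => i.
  by apply: measurable_funB => //; exact: measurable_funP.
pose Y' : {RV P >-> R} := HB.pack Y (isMeasurableFun.Build _ _ _ _ _ mY).
have -> : [set t | b <= s * (sample_mean X t - mu)] = [set t | n%:R * b <= Y' t].
  apply/seteqP; split=> t /=; rewrite /Y -sample_mean_dev mulrCA ler_pM2l// ltr0n//.
apply: le_trans (chernoff _ _ ltr01) _.
have m0 : 0 <= fine 'E_F[f] by exact: fine_ge0.
have mM : fine 'E_F[f] <= M by rewrite -lee_fin fineK.
have -> : ('M_P Y' 1 = (fine 'E_F[f] ^+ n)%:E)%E.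
  rewrite /mmt_gen_fun (_ : _ \o _ = fun t => \prod_(i < n) f (X i t)).
    rewrite (expectation_prod_indep (f := fun=> f) indX)//; last first.
      by move=> i; rewrite EX.
    under eq_bigr do rewrite EX -(fineK EFfin).
    by rewrite prodEFin prodr_const card_ord.
  by apply/funext => t /=; rewrite mulr1 /Y mulr_sumr expR_sum.
rewrite mul1r -mulrN expRM_natl exprMn -EFinM lee_fin.
by rewrite ler_wpM2r ?exprn_ge0 ?expR_ge0// lerXn2r ?nnegrE// (le_trans m0).
Qed.

Lemma sample_mean_tail (F : probability R R) (mu t b M : R) :
  0 < t ->
  iid_sample X F ->
  (forall s, `|s| = t -> ('E_F[fun x : R => expR (s * (x - mu))%R] <= M%:E)%E) ->
  (P [set u | (b < `|sample_mean X u - mu|)%R]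
     <= (2 * (M * expR (- (t * b))) ^+ n)%:E)%E.
Proof.
move=> t0 iid EM.
have mset s : measurable [set u | t * b <= s * (sample_mean X u - mu)].
  rewrite -[X in measurable X]setTI.
  have mf : measurable_fun setT (fun u => s * (sample_mean X u - mu)).
    apply: measurable_funM => //; apply: measurable_funB => //.
    exact: measurable_sample_mean.
  by have := mf measurableT `[t * b, +oo[%classic (measurable_itv _); rewrite set_itvcy.
apply: (@le_trans _ _ (P ([set u | t * b <= t * (sample_mean X u - mu)] `|`
    [set u | t * b <= - t * (sample_mean X u - mu)]))).
  apply: le_measure; rewrite ?inE; [exact: measurable_sample_mean_dev|exact: measurableU|].
  move=> u /= bu; have [x0|x0] := leP 0 (sample_mean X u - mu).
    by left; rewrite ler_pM2l// ltW// -[ltRHS]ger0_norm.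
  by right; rewrite mulNr -mulrN ler_pM2l// ltW// -[ltRHS]ltr0_norm.
apply: le_trans (measureU2 _ _ _) _ => //.
rewrite mulr_natl mulr2n EFinD; apply: leeD;
  by apply: (sample_mean_chernoff _ iid); apply: EM; rewrite ?normrN gtr0_norm.
Qed.
End sample_mean_tail.

(** * Cost of conditioning on selection *)

Section selection.
Context {d : measure_display} {T : measurableType d} {R : realType}.
Variable P : probability T R.

Lemma logistic_upper_tail (kappa w : R) (Y : {RV P >-> R}) :
  0 < kappa -> 0 <= w -> logistic_law kappa Y ->
  ((expR (- (kappa * w)) / 2)%:E <= P [set t | (w < Y t)%R])%E.
Proof.
move=> k0 w0 lawY.
have -> : P [set t | w < Y t] = ccdf Y w.
  by rewrite /ccdf/= /distribution /pushforward set_itvoy.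
rewrite ccdf_1_cdf lawY -EFinB lee_fin expRN.
have e1 : 1 <= expR (kappa * w).
  by rewrite -[leLHS]expR0 ler_expR mulr_ge0// ltW.
set e := expR _ in e1 *.
have -> : 1 - e / (1 + e) = (1 + e)^-1 by field; lra.
rewrite -invfM lef_pV2 ?posrE; lra.
Qed.

(** Selection already happens when the mean is close to [mu], an event of
    probability at least [1 / 2], and [omega] exceeds
    [2 + Num.sqrt n%:R * (eps - mu)]; these are independent.  The factor [4]
    is the inverse of this [1 / 2] times the [1 / 2] of
    [logistic_upper_tail]. *)
Lemma cond_prob_selection_le (n : nat) (X : 'I_n -> {RV P >-> R})
    (omega : {RV P >-> R}) (kappa mu eps q : R) :
  (0 < n)%N -> 0 < kappa -> 0 <= eps - mu ->
  logistic_law kappa omega -> independent_of_data X omega ->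
  (P [set t | (eps < `|sample_mean X t - mu|)%R] <= q%:E)%E -> q <= 1 / 2 ->
  cond_prob P [set t | eps < `|sample_mean X t - mu|]
    [set t | 2 < Num.sqrt n%:R * sample_mean X t + omega t]
  <= 4 * q * expR (kappa * (2 + Num.sqrt n%:R * (eps - mu))).
Proof.
move=> n0 k0 L0 lawO indO; set A := [set t | _]; set B := [set t | _] => PA q2.
set r := Num.sqrt n%:R; set w := 2 + r * (eps - mu).
have r0 : 0 <= r by exact: sqrtr_ge0.
have w0 : 0 <= w by rewrite addr_ge0// mulr_ge0.
have mmean := measurable_sample_mean X.
have mA : measurable A by exact: measurable_sample_mean_dev.
have mB : measurable B.
  rewrite -[X in measurable X]setTI.
  have mf : measurable_fun setT (fun t => r * sample_mean X t + omega t).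
    apply: measurable_funD; first exact: measurable_funM.
    exact: measurable_funP.
  by have := mf measurableT `]2, +oo[%classic (measurable_itv _); rewrite set_itvoy.
pose S := [set t | w < omega t].
have SE : S = omega @^-1` `]w, +oo[ by rewrite set_itvoy.
have mS : measurable S.
  by rewrite SE -[X in measurable X]setTI; exact: measurable_funP.
have gA : g_sigma_preimage (fun i => X i : T -> R) (~` A).
  have -> : ~` A = sample_mean X @^-1` [set x | `|x - mu| <= eps].
    by apply/seteqP; split => t /=; rewrite leNgt => /negP.
  apply: g_sigma_sample_mean_preimage.
  have mf : measurable_fun setT (fun x : R => `|x - mu|).
    by apply: measurableT_comp => //; exact: measurable_funB.
  have := mf measurableT `]-oo, eps]%classic (measurable_itv _).
  by rewrite setTI set_itvNyc.
have PAS : P (~` A `&` S) = (P (~` A) * P S)%E.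
  by rewrite SE; apply: indO => //; exact: measurable_itv.
have ASB : ~` A `&` S `<=` B.
  move=> t [/negP]; rewrite -leNgt ler_norml /S /B /= => /andP[h _] wt.
  have : r * (mu - eps) <= r * sample_mean X t by rewrite ler_wpM2l//; lra.
  by move: wt; rewrite -/r /w !mulrBr; lra.
have PnA : ((1 / 2)%:E <= P (~` A))%E.
  rewrite probability_setC// -[P A]fineK ?fin_num_measure// -EFinB lee_fin.
  by move: PA; rewrite -[P A]fineK ?fin_num_measure// lee_fin; lra.
have PB : ((expR (- (kappa * w)) / 4)%:E <= P B)%E.
  apply: (@le_trans _ _ (P (~` A `&` S))); last first.
    by apply: le_measure; rewrite ?inE//; apply: measurableI => //; exact: measurableC.
  rewrite PAS (_ : _ / 4 = 1 / 2 * (expR (- (kappa * w)) / 2)); last by field.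
  rewrite EFinM lee_pmul// ?lee_fin ?divr_ge0 ?expR_ge0//.
  exact: logistic_upper_tail.
have fB : expR (- (kappa * w)) / 4 <= fine (P B).
  by rewrite -lee_fin fineK// fin_num_measure.
have fB0 : 0 < fine (P B) by rewrite (lt_le_trans _ fB)// divr_gt0// expR_gt0.
have fAB : fine (P (A `&` B)) <= q.
  rewrite -lee_fin fineK ?fin_num_measure//; last exact: measurableI.
  by apply: le_trans PA; apply: le_measure; rewrite ?inE//; exact: measurableI.
rewrite /cond_prob ler_pdivrMr//.
have q0 : 0 <= q by rewrite (le_trans _ fAB)// fine_ge0.
apply: (le_trans fAB).
apply: (@le_trans _ _ (4 * q * expR (kappa * w) * (expR (- (kappa * w)) / 4))).
  by rewrite expRN le_eqVlt; apply/orP; left; apply/eqP; field; rewrite gt_eqF// expR_gt0.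
by rewrite ler_wpM2l// mulr_ge0 ?expR_ge0// mulr_ge0.
Qed.
End selection.

(** * Comparison of rates *)

Section rate.
Context {R : realType}.

Lemma cvg_geometric_expR (D c : R) : 0 < c -> D * expR (- (c * n%:R)) @[n --> \oo] --> 0.
Proof.
move=> c0.
have -> : (fun n => D * expR (- (c * n%:R))) = geometric D (expR (- c)).
  by apply/funext => n; rewrite -mulNr expRM_natr.
by apply: cvg_geometric; rewrite ger0_norm ?expR_ge0// -expR0 ltr_expR oppr_lt0.
Qed.

(** For [1 <= Num.sqrt n%:R] the left-hand side is at most
    [k * (2 + L) * Num.sqrt n%:R], which is why the threshold is
    [k * (2 + L) / c]. *)
Lemma sqrt_le_linear (k L c : R) : 0 <= k -> 0 <= L -> 0 < c ->
  \forall n \near \oo, k * (2 + Num.sqrt n%:R * L) <= c * n%:R.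
Proof.
move=> k0 L0 c0; set D := k * (2 + L) / c.
have D0 : 0 <= D by rewrite divr_ge0 ?mulr_ge0// ?addr_ge0// ltW.
near=> n.
have n1 : 1 <= n%:R :> R by near: n; exact: nbhs_infty_ger.
have nD : D ^+ 2 <= n%:R by near: n; exact: nbhs_infty_ger.
set r := Num.sqrt n%:R.
have rn : r ^+ 2 = n%:R by rewrite sqr_sqrtr.
have r1 : 1 <= r by rewrite -sqrtr1 ler_sqrt// ltr0n.
have rD : D <= r by rewrite -[leLHS]ger0_norm// -sqrtr_sqr ler_wsqrtr.
rewrite -rn.
have : k * (2 + L) <= c * r by move: rD; rewrite ler_pdivrMr// [_ * c]mulrC.
move=> /(ler_wpM2r (ltW (lt_le_trans ltr01 r1))); rewrite -!mulrA -expr2.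
by apply: le_trans; rewrite ler_wpM2l// mulrDl [r * L]mulrC lerD2r ler_peMr.
Unshelve. all: by end_near. Qed.
End rate.

(** * Consistency after selection *)

Theorem lemma4 (R : realType)
  (d : nat -> measure_display) (T : forall n : nat, measurableType (d n))
  (P : forall n : nat, probability (T n) R)
  (F : nat -> probability R R)
  (X : forall n : nat, 'I_n -> {RV (P n) >-> R})
  (omega : forall n : nat, {RV (P n) >-> R})
  (mu kappa : R)
  (mu_lt0 : mu < 0)
  (kappa_gt0 : 0 < kappa)
  (iidX : forall n : nat, (0 < n)%N -> iid_sample (X n) (F n))
  (meanF : forall n : nat, (0 < n)%N -> ('E_(F n)[fun x : R => x] = mu%:E)%E)
  (varF : forall n : nat, (0 < n)%N -> ('V_(F n)[fun x : R => x] = 1)%E)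
  (logistic_omega : forall n : nat, (0 < n)%N -> logistic_law kappa (omega n))
  (indep_omega : forall n : nat, (0 < n)%N ->
     independent_of_data (X n) (omega n))
  (exp_moment : exists a C : R, 0 < a /\
     forall n : nat, (0 < n)%N ->
       ('E_(F n)[fun x : R => expR (a * `|x - mu|)%R] <= C%:E)%E) :
  forall eps : R, 0 < eps ->
    cond_prob (P n)
        [set t | eps < `|sample_mean (X n) t - mu|]
        [set t | 2 < Num.sqrt n%:R * sample_mean (X n) t + omega n t]
      @[n --> \oo] --> (0 : R).
Proof.
move=> eps eps0; have [a [C [a0 EC]]] := exp_moment.
(* Enlarging C to |C| + 1 makes K positive, so that K can be divided by. *)
have [K [K0 KE]] : exists K, 0 < K /\ 16 * (`|C| + 1) / a ^+ 2 = K.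
  by eexists; split; last reflexivity; rewrite divr_gt0 ?exprn_gt0// mulr_gt0// ltr_wpDl.
(* With K * t <= eps / 2 the Chernoff exponent K * t^2 - t * eps is at most
   - t * eps / 2. *)
have [t [t0 ta tK]] : exists t, [/\ 0 < t, t <= a / 2 & K * t <= eps / 2].
  exists (Num.min (a / 2) (eps / 2 / K)).
  rewrite lt_min !divr_gt0//; split => //; first by rewrite ge_min lexx.
  by rewrite mulrC -ler_pdivlMr// ge_min lexx orbT.
pose c := t * eps / 2.
have c0 : 0 < c by rewrite divr_gt0// mulr_gt0.
have tail n : (0 < n)%N ->
    (P n [set u | (eps < `|sample_mean (X n) u - mu|)%R]
      <= (2 * expR (- (c * n%:R)))%:E)%E.
  move=> n0.
  have mgf s : `|s| = t -> ('E_(F n)[fun x : R => expR (s * (x - mu))%R]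
      <= (expR (K * t ^+ 2))%:E)%E.
    move=> st; rewrite -KE -st real_normK ?num_real//.
    apply: mgf_bound => //; [exact: meanF| |by rewrite st].
    apply: le_trans (EC n n0) _; rewrite lee_fin.
    by rewrite (le_trans (ler_norm _))// lerDl.
  apply: le_trans (sample_mean_tail n0 eps t0 (iidX n n0) mgf) _.
  rewrite lee_fin ler_wpM2l// -expRD -expRM_natr ler_expR -(mulNr c) ler_wpM2r//.
  have : t * (K * t) <= t * (eps / 2) by rewrite ler_wpM2l// ltW.
  by rewrite /c expr2; lra.
have L0 : 0 <= eps - mu by lra.
apply: (@squeeze_cvgr _ _ _ _ (fun=> 0) (fun n => 8 * expR (- (c / 2 * n%:R)))).
(* Half of the exponent c * n absorbs the selection cost. *)
- near=> n.
  have n0 : (0 < n)%N by near: n; exact: nbhs_infty_gt.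
  have qle : 2 * expR (- (c * n%:R)) <= 1 / 2.
    near: n; have := cvg_geometric_expR 2 c0.
    by move/cvgr_le; apply; lra.
  have lin : kappa * (2 + Num.sqrt n%:R * (eps - mu)) <= c / 2 * n%:R.
    by near: n; apply: sqrt_le_linear => //; [exact: ltW|exact: divr_gt0].
  rewrite divr_ge0 ?fine_ge0//=.
  have := cond_prob_selection_le n0 kappa_gt0 L0 (logistic_omega n n0)
    (indep_omega n n0) (tail n n0) qle.
  move/le_trans; apply.
  rewrite mulrA (_ : 4 * 2 = 8 :> R); last by lra.
  rewrite -mulrA ler_wpM2l// -expRD ler_expR; lra.
- exact: cvg_cst.
- by apply: cvg_geometric_expR; rewrite divr_gt0.
Unshelve. all: by end_near. Qed.
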